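(* Let $(P,\cdot_P,\{-,-\}_P)$ be a noncommutative Poisson algebra and $T:V\to P$ an $\mathcal O$-operator on $P$ with respect to a representation $(V;\mathcal L,\mathcal R,\rho)$. Define new operations $\succ,\prec,\ast$ on $V$ by $$u\succ v=\mathcal L_{T(u)}v,\qquad u\prec v=\mathcal R_{T(v)}u,\qquad u\ast v=\rho(T(u))v,\qquad u,v\in V.$$ Then $(V,\succ,\prec,\ast)$ is a noncommutative pre-Poisson algebra and $T$ is a homomorphism of noncommutative Poisson algebras from the sub-adjacent noncommutative Poisson algebra $V^c$ to $(P,\cdot_P,\{-,-\}_P)$. Furthermore, if the representation satisfies $\rho(x\cdot_Py)=\rho(x)\mathcal L_y+\rho(y)\mathcal R_x$ for all $x,y\in P$, then $(V,\succ,\prec,\ast)$ is a coherent noncommutative pre-Poisson algebra.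
   Context: All vector spaces are finite dimensional over an algebraically closed field of characteristic $0$. A noncommutative Poisson algebra $(P,\cdot_P,\{-,-\}_P)$ is a vector space with an associative (not necessarily commutative) product and a Lie bracket such that $\{x,y\cdot_Pz\}_P=\{x,y\}_P\cdot_Pz+y\cdot_P\{x,z\}_P$. A representation of $P$ is $(V;\mathcal L,\mathcal R,\rho)$ with linear maps $\mathcal L,\mathcal R,\rho:P\to\mathfrak{gl}(V)$ such that for all $x,y$: $\mathcal L_{x\cdot_P y}=\mathcal L_x\mathcal L_y$, $\mathcal R_{x\cdot_P y}=\mathcal R_y\mathcal R_x$, $\mathcal L_x\mathcal R_y=\mathcal R_y\mathcal L_x$, $\rho(\{x,y\}_P)=[\rho(x),\rho(y)]$, $\mathcal L_{\{x,y\}_P}=\rho(x)\mathcal L_y-\mathcal L_y\rho(x)$, $\mathcal R_{\{x,y\}_P}=\rho(x)\mathcal R_y-\mathcal R_y\rho(x)$, $\rho(x\cdot_Py)=\mathcal L_x\rho(y)+\mathcal R_y\rho(x)$. A linear map $T:V\to P$ is an $\mathcal O$-operator on $P$ with respect to $(V;\mathcal L,\mathcal R,\rho)$ if for all $u,v\in V$: $T(u)\cdot_PT(v)=T(\mathcal L_{T(u)}v+\mathcal R_{T(v)}u)$ and $\{T(u),T(v)\}_P=T\big(\rho(T(u))(v)-\rho(T(v))(u)\big)$. A dendriform algebra $(A,\succ,\prec)$: bilinear operations with $(x\prec y)\prec z=x\prec(y\succ z+y\prec z)$, $(x\succ y)\prec z=x\succ(y\prec z)$, $x\succ(y\succ z)=(x\succ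 y+x\prec y)\succ z$. A pre-Lie algebra $(A,\ast)$: a bilinear operation with $(x\ast y)\ast z-x\ast(y\ast z)=(y\ast x)\ast z-y\ast(x\ast z)$. A noncommutative pre-Poisson algebra is $(A,\succ,\prec,\ast)$ such that $(A,\succ,\prec)$ is dendriform, $(A,\ast)$ is pre-Lie and, for all $x,y,z\in A$, $(x\ast y-y\ast x)\succ z=x\ast(y\succ z)-y\succ(x\ast z)$, $x\prec(y\ast z-z\ast y)=y\ast(x\prec z)-(y\ast x)\prec z$, $(x\succ y+x\prec y)\ast z=(x\ast z)\prec y+x\succ(y\ast z)$. It is coherent if also $(x\succ y+x\prec y)\ast z=x\ast(y\succ z)+y\ast(z\prec x)$. Its sub-adjacent noncommutative Poisson algebra $A^c$ is $A$ with product $x\cdot y=x\succ y+x\prec y$ and bracket $\{x,y\}=x\ast y-y\ast x$. *)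

(* Defs.v *)
From HB Require Import structures.
From mathcomp Require Import all_boot all_algebra.

Set Implicit Arguments.
Unset Strict Implicit.
Unset Printing Implicit Defensive.

Import GRing.Theory.
Local Open Scope ring_scope.

Section Algebras.

Variables (k : fieldType) (A : vectType k).
Implicit Types (mul br succ prec ast : A -> A -> A).

Definition is_bilinear mul : Prop :=
  (forall y, linear (fun x => mul x y)) /\ (forall x, linear (mul x)).

Record is_lie_bracket br : Prop := IsLieBracket {
  lie_bilinear : is_bilinear br;
  lie_alternating : forall x, br x x = 0;
  lie_jacobi : forall x y z,
    br x (br y z) + br y (br z x) + br z (br x y) = 0
}.

(* The product need be neither commutative nor unital. *)
Record is_ncPoisson mul br : Prop := IsNcPoisson {
  ncPoisson_bilinear : is_bilinear mul;
  ncPoisson_assoc : associative mul;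
  ncPoisson_lie : is_lie_bracket br;
  ncPoisson_leibniz : forall x y z,
    br x (mul y z) = mul (br x y) z + mul y (br x z)
}.

Record is_dendriform succ prec : Prop := IsDendriform {
  dendriform_succ_bilinear : is_bilinear succ;
  dendriform_prec_bilinear : is_bilinear prec;
  dendriform_prec_prec : forall x y z,
    prec (prec x y) z = prec x (succ y z + prec y z);
  dendriform_succ_prec : forall x y z,
    prec (succ x y) z = succ x (prec y z);
  dendriform_succ_succ : forall x y z,
    succ x (succ y z) = succ (succ x y + prec x y) z
}.

Record is_preLie ast : Prop := IsPreLie {
  preLie_bilinear : is_bilinear ast;
  preLie_identity : forall x y z,
    ast (ast x y) z - ast x (ast y z) = ast (ast y x) z - ast y (ast x z)
}.

Record is_ncPrePoisson succ prec ast : Prop := IsNcPrePoisson {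
  ncPrePoisson_dendriform : is_dendriform succ prec;
  ncPrePoisson_preLie : is_preLie ast;
  ncPrePoisson_succ : forall x y z,
    succ (ast x y - ast y x) z = ast x (succ y z) - succ y (ast x z);
  ncPrePoisson_prec : forall x y z,
    prec x (ast y z - ast z y) = ast y (prec x z) - prec (ast y x) z;
  ncPrePoisson_ast : forall x y z,
    ast (succ x y + prec x y) z = prec (ast x z) y + succ x (ast y z)
}.

Record is_coherent_ncPrePoisson succ prec ast : Prop :=
  IsCoherentNcPrePoisson {
  coherent_ncPrePoisson : is_ncPrePoisson succ prec ast;
  coherent_identity : forall x y z,
    ast (succ x y + prec x y) z = ast x (succ y z) + ast y (prec z x)
}.

Definition subadjacent_mul succ prec : A -> A -> A :=
  fun x y => succ x y + prec x y.

Definition subadjacent_br ast : A -> A -> A := fun x y => ast x y - ast y x.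

End Algebras.

(* Being a homomorphism of noncommutative Poisson algebras includes that both
   the source and the target are noncommutative Poisson algebras. *)
Record is_ncPoisson_hom (k : fieldType) (A B : vectType k)
    (mulA brA : A -> A -> A) (mulB brB : B -> B -> B) (f : A -> B) : Prop :=
  IsNcPoissonHom {
  ncPoisson_hom_source : is_ncPoisson mulA brA;
  ncPoisson_hom_target : is_ncPoisson mulB brB;
  ncPoisson_hom_linear : linear f;
  ncPoisson_hom_mul : forall x y, f (mulA x y) = mulB (f x) (f y);
  ncPoisson_hom_br : forall x y, f (brA x y) = brB (f x) (f y)
}.

Section Representations.

Variables (k : fieldType) (P V : vectType k) (mul br : P -> P -> P).
Implicit Types (L R rho : 'Hom(P, 'End(V))).

Record is_representation L R rho : Prop := IsRepresentation {
  rep_L_mul : forall x y, L (mul x y) = (L x \o L y)%VF;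
  rep_R_mul : forall x y, R (mul x y) = (R y \o R x)%VF;
  rep_LR : forall x y, (L x \o R y)%VF = (R y \o L x)%VF;
  rep_rho_br : forall x y,
    rho (br x y) = (rho x \o rho y)%VF - (rho y \o rho x)%VF;
  rep_L_br : forall x y, L (br x y) = (rho x \o L y)%VF - (L y \o rho x)%VF;
  rep_R_br : forall x y, R (br x y) = (rho x \o R y)%VF - (R y \o rho x)%VF;
  rep_rho_mul : forall x y,
    rho (mul x y) = (L x \o rho y)%VF + (R y \o rho x)%VF
}.

Record is_O_operator L R rho (T : 'Hom(V, P)) : Prop := IsOOperator {
  O_operator_mul : forall u v,
    mul (T u) (T v) = T (L (T u) v + R (T v) u);
  O_operator_br : forall u v,
    br (T u) (T v) = T (rho (T u) v - rho (T v) u)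
}.

End Representations.

(* Main.v *)
(* Each axiom on V is a representation axiom evaluated on V, once the O-operator
   identities turn T (u succ v + u prec v) and T (u ast v - v ast u) into the
   product and the bracket of T u and T v.  That V^c is a noncommutative Poisson
   algebra uses only the pre-Poisson axioms. *)

Require Import Defs.
From HB Require Import structures.
From mathcomp Require Import all_boot all_algebra.

Set Implicit Arguments.
Unset Strict Implicit.
Unset Printing Implicit Defensive.

Import GRing.Theory.
Local Open Scope ring_scope.

(** Trades the symmetric-associator form of the pre-Lie identity for the form in which left
    multiplications represent the commutator, and back. *)
Lemma subr_swap (V : zmodType) (a b c d : V) : a - b = c - d -> a - c = b - d.
Proof.
by move=> e; apply/eqP; rewrite subr_eq addrAC -addrA -e addrC subrK.
Qed.

Section Bilinear.

Variables (k : fieldType) (A : vectType k) (f g : A -> A -> A).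

(** Lets the lemmas on the left argument serve for the right one. *)
Lemma bilinear_flip : is_bilinear f -> is_bilinear (fun x y => f y x).
Proof. by case. Qed.

Lemma bilinearDl : is_bilinear f -> forall x y z, f (x + y) z = f x z + f y z.
Proof. by move=> [fl _] x y z; have := fl z 1 x y; rewrite /= !scale1r. Qed.

Lemma bilinearD : is_bilinear f -> is_bilinear g ->
  is_bilinear (fun x y => f x y + g x y).
Proof.
move=> [fl fr] [gl gr]; split=> [y|x] a u v.
  by rewrite fl gl scalerDr addrACA.
by rewrite fr gr scalerDr addrACA.
Qed.

Lemma bilinearN : is_bilinear f -> is_bilinear (fun x y => - f x y).
Proof.
by move=> [fl fr]; split=> [y|x] a u v; rewrite ?fl ?fr opprD scalerN.
Qed.

Lemma bilinearBl : is_bilinear f -> forall x y z, f (x - y) z = f x z - f y z.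
Proof.
move=> fB x y z; apply/eqP; rewrite eq_sym subr_eq -bilinearDl //.
by rewrite subrK.
Qed.

End Bilinear.

Section Subadjacent.

Variables (k : fieldType) (A : vectType k) (succ prec ast : A -> A -> A).

(** Both bracketings expand to [succ x (succ y z)], [succ x (prec y z)] and
    [prec x (succ y z + prec y z)], with one dendriform axiom for each term. *)
Lemma subadjacent_mul_assoc :
  is_dendriform succ prec -> associative (subadjacent_mul succ prec).
Proof.
move=> [sB pB pp sp ss] x y z; rewrite /subadjacent_mul -ss.
have sDr := bilinearDl (bilinear_flip sB).
by rewrite (bilinearDl pB) pp sp sDr addrA.
Qed.

Lemma subadjacent_br_lie : is_preLie ast -> is_lie_bracket (subadjacent_br ast).
Proof.
move=> [aB aA]; rewrite /subadjacent_br; split.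
- by apply: bilinearD => //; apply/bilinearN/bilinear_flip.
- by move=> x; rewrite subrr.
have aBr := bilinearBl (bilinear_flip aB).
have brE x y z : ast (ast x y - ast y x) z = ast x (ast y z) - ast y (ast x z).
  by rewrite (bilinearBl aB); apply/subr_swap/aA.
have jacE x y z : ast x (ast y z - ast z y) - ast (ast y z - ast z y) x =
    (ast x (ast y z) + ast z (ast y x)) - (ast x (ast z y) + ast y (ast z x)).
  by rewrite aBr brE opprB addrACA opprD.
move=> x y z; rewrite !jacE.
(* Up to the order of summands, the three cyclic terms now read [a - b], [b - c], [c - a], so the
   Jacobi sum telescopes. *)
rewrite [ast y (ast z x) + _]addrC subrKA.
rewrite [ast z (ast x y) + _]addrC [ast z (ast y x) + _]addrC.
by rewrite subrKA subrr.
Qed.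

Lemma subadjacent_ncPoisson : is_ncPrePoisson succ prec ast ->
  is_ncPoisson (subadjacent_mul succ prec) (subadjacent_br ast).
Proof.
move=> [dA pA bs bp ba]; split.
- by apply: bilinearD; [apply: dendriform_succ_bilinear dA
                       |apply: dendriform_prec_bilinear dA].
- exact: subadjacent_mul_assoc.
- exact: subadjacent_br_lie.
move=> x y z; case: dA pA => sB pB _ _ _ [aB _].
have sBr := bilinearBl (bilinear_flip sB).
(* The axioms [bs] and [bp], solved for [ast x (succ y z)] and [ast x (prec y z)], give one half of
   the bracket of [x] with the product; [ba] gives the other half. *)
have astE : ast x (succ y z + prec y z) =
    (succ (ast x y - ast y x) z + succ y (ast x z)) +
    (prec (ast x y) z + prec y (ast x z - ast z x)).
  rewrite (bilinearDl (bilinear_flip aB)) bs subrK.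
  by rewrite bp [prec (ast x y) z + _]addrC subrK.
rewrite /subadjacent_mul /subadjacent_br astE ba (bilinearBl pB) sBr opprD.
by rewrite [LHS](AC (2*2*2) ((1*(3*5))*((2*6)*4))).
Qed.

End Subadjacent.

Lemma bilinear_of_Hom (k : fieldType) (P V : vectType k)
    (M : 'Hom(P, 'End(V))) (T : 'Hom(V, P)) :
  is_bilinear (fun u v => M (T u) v).
Proof.
split=> [v|u] a x y /=; last exact: linearP.
by rewrite !linearP /= add_lfunE scale_lfunE.
Qed.

Theorem theorem5p18
    (k : closedFieldType) (char_k : [pchar k] =i pred0)
    (P V : vectType k) (mulP brP : P -> P -> P)
    (P_ncPoisson : is_ncPoisson mulP brP)
    (L R rho : 'Hom(P, 'End(V)))
    (V_rep : is_representation mulP brP L R rho)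
    (T : 'Hom(V, P)) (T_O : is_O_operator mulP brP L R rho T) :
  let succ : V -> V -> V := fun u v => L (T u) v in
  let prec : V -> V -> V := fun u v => R (T v) u in
  let ast : V -> V -> V := fun u v => rho (T u) v in
  [/\ is_ncPrePoisson succ prec ast,
      is_ncPoisson_hom (subadjacent_mul succ prec) (subadjacent_br ast)
        mulP brP T &
      (forall x y : P,
         rho (mulP x y) = (rho x \o L y)%VF + (rho y \o R x)%VF) ->
      is_coherent_ncPrePoisson succ prec ast].
Proof.
move=> succ prec ast; case: T_O => Tmul Tbr.
have prePoisson : is_ncPrePoisson succ prec ast.
  have sB : is_bilinear succ by exact: bilinear_of_Hom.
  have pB : is_bilinear prec by exact/bilinear_flip/bilinear_of_Hom.
  have aB : is_bilinear ast by exact: bilinear_of_Hom.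
  case: V_rep => LM RM LR rhoB LB RB rhoM.
  rewrite /succ /prec /ast; split.
  (* The three dendriform axioms use, in order, that [R] reverses products, that [L] and [R]
     commute, and that [L] preserves products. *)
  - split=> // x y z.
    + by rewrite -Tmul RM comp_lfunE.
    + by rewrite -comp_lfunE -LR comp_lfunE.
    + by rewrite -Tmul LM comp_lfunE.
  - split=> // x y z.
    apply: subr_swap; rewrite -(bilinearBl aB) /ast -Tbr rhoB.
    by rewrite add_lfunE opp_lfunE !comp_lfunE.
  - by move=> x y z; rewrite -Tbr LB add_lfunE opp_lfunE !comp_lfunE.
  - by move=> x y z; rewrite -Tbr RB add_lfunE opp_lfunE !comp_lfunE.
  - by move=> x y z; rewrite -Tmul rhoM add_lfunE !comp_lfunE addrC.
split=> // [|rhoC].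
  split=> // [||u v|u v]; first exact: subadjacent_ncPoisson.
  - exact: linearP.
  - by rewrite Tmul.
  - by rewrite Tbr.
(* [rhoC] expands the same left-hand side as the last pre-Poisson axiom, now with [rho] outermost;
   [R (T x) z] is [prec z x], whence the flipped arguments. *)
split=> // x y z; rewrite /succ /prec /ast -Tmul rhoC.
by rewrite add_lfunE !comp_lfunE.
Qed.
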